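(* There is an algorithm that, given an instance $(Q,c,d)$ of the bipartite boolean quadratic programming problem (BBQP) with $Q$ an $m\times n$ matrix, computes in $O(mn)$ time a solution $(\bar x,\bar y)\in\{0,1\}^m\times\{0,1\}^n$ satisfying $f(\bar x,\bar y)\ge\mathcal{A}(Q,c,d)$.
   Context: A BBQP instance is given by an $m\times n$ matrix $Q$ and row vectors $c$ (of length $m$) and $d$ (of length $n$); the problem is to maximize $f(x,y)=x^TQy+cx+dy$ over $x\in\{0,1\}^m$, $y\in\{0,1\}^n$. The average value of all solutions is $\mathcal{A}(Q,c,d)=2^{-(m+n)}\sum_{(x,y)\in\{0,1\}^m\times\{0,1\}^n}f(x,y)$. Time is counted in elementary arithmetic operations and comparisons on the data. *)

(* Defs.v *)
From HB Require Import structures.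
From mathcomp Require Import all_boot all_order all_algebra.

Set Implicit Arguments.
Unset Strict Implicit.
Unset Printing Implicit Defensive.

Import Order.TTheory GRing.Theory Num.Theory.

Local Open Scope ring_scope.

Section BBQP.
Variable R : realFieldType.

Definition bitvec (k : nat) (x : 'cV[bool]_k) : 'cV[R]_k :=
  map_mx (fun b : bool => b%:R) x.

Section Instance.
Variables (m n : nat) (Q : 'M[R]_(m, n)) (c : 'rV[R]_m) (d : 'rV[R]_n).

Definition bbqp_obj (x : 'cV[bool]_m) (y : 'cV[bool]_n) : R :=
  ((bitvec x)^T *m Q *m bitvec y + c *m bitvec x + d *m bitvec y) 0 0.

Definition bbqp_avg : R :=
  (2 ^+ (m + n))^-1 *
  \sum_(s : 'cV[bool]_m * 'cV[bool]_n) bbqp_obj s.1 s.2.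

End Instance.
End BBQP.

(* A unit-cost real RAM with structured control.  The machine has natural-number index registers, scalar registers holding
   elements of R, and scalar arrays, all named by natural numbers.  A scalar
   can influence an index only through a comparison, and indices support only
   addition and truncated subtraction.  A program mentions no element of R
   and no dimension, so one program is meant to serve all instances. *)

Inductive instr : Type :=
  | IConst (r k : nat)
  | IAdd (r a b : nat)
  | ISub (r a b : nat)
  | SConst (r k : nat)
  | SAdd (r a b : nat)
  | SSub (r a b : nat)
  | SMul (r a b : nat)
  | SDiv (r a b : nat)
  | ALoad (r arr i : nat)    (* scalar register r := arr[index register i] *)
  | AStore (arr i r : nat).  (* arr[index register i] := scalar register r *)

Inductive test : Type :=
  | ILt (a b : nat)
  | IEq (a b : nat)
  | SLt (a b : nat)
  | SEq (a b : nat).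

Inductive program : Type :=
  | Skip
  | Do (i : instr)
  | Seq (p q : program)
  | If (b : test) (p q : program)
  | While (b : test) (p : program).

Definition upd (T : Type) (f : nat -> T) (k : nat) (v : T) : nat -> T :=
  fun i => if i == k then v else f i.

Section Semantics.
Variable R : realFieldType.

Record state : Type := State {
  ireg : nat -> nat;
  sreg : nat -> R;
  arr : nat -> nat -> R
}.

Definition set_ireg (s : state) (r v : nat) : state :=
  State (upd (ireg s) r v) (sreg s) (arr s).

Definition set_sreg (s : state) (r : nat) (v : R) : state :=
  State (ireg s) (upd (sreg s) r v) (arr s).

Definition set_arr (s : state) (a k : nat) (v : R) : state :=
  State (ireg s) (sreg s) (upd (arr s) a (upd (arr s a) k v)).

(* Division by zero has no successor state. *)
Definition step (i : instr) (s : state) : option state :=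
  match i with
  | IConst r k => Some (set_ireg s r k)
  | IAdd r a b => Some (set_ireg s r (ireg s a + ireg s b)%N)
  | ISub r a b => Some (set_ireg s r (ireg s a - ireg s b)%N)
  | SConst r k => Some (set_sreg s r k%:R)
  | SAdd r a b => Some (set_sreg s r (sreg s a + sreg s b))
  | SSub r a b => Some (set_sreg s r (sreg s a - sreg s b))
  | SMul r a b => Some (set_sreg s r (sreg s a * sreg s b))
  | SDiv r a b => if sreg s b == 0 then None
                  else Some (set_sreg s r (sreg s a / sreg s b))
  | ALoad r a i => Some (set_sreg s r (arr s a (ireg s i)))
  | AStore a i r => Some (set_arr s a (ireg s i) (sreg s r))
  end.

Definition eval_test (b : test) (s : state) : bool :=
  match b with
  | ILt a b => (ireg s a < ireg s b)%N
  | IEq a b => ireg s a == ireg s b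
  | SLt a b => sreg s a < sreg s b
  | SEq a b => sreg s a == sreg s b
  end.

(* [exec p s t s']: started in s, p halts in s' after t unit-cost steps.
   Every executed instruction and every evaluated test is charged, including
   those on indices, so t bounds the number of operations and comparisons
   performed on the scalars. *)
Inductive exec : program -> state -> nat -> state -> Prop :=
  | exec_skip s : exec Skip s 1 s
  | exec_do i s s' : step i s = Some s' -> exec (Do i) s 1 s'
  | exec_seq p q s s1 s2 t1 t2 :
      exec p s t1 s1 -> exec q s1 t2 s2 -> exec (Seq p q) s (t1 + t2) s2
  | exec_if b p q s s' t :
      exec (if eval_test b s then p else q) s t s' ->
      exec (If b p q) s t.+1 s'
  | exec_while_done b p s :
      ~~ eval_test b s -> exec (While b p) s 1 s
  | exec_while_loop b p s s1 s2 t1 t2 :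
      eval_test b s -> exec p s t1 s1 -> exec (While b p) s1 t2 s2 ->
      exec (While b p) s (t1 + t2).+1 s2.

Lemma exec_det p s t1 s1 t2 s2 :
  exec p s t1 s1 -> exec p s t2 s2 -> t1 = t2 /\ s1 = s2.
Proof.
move=> e1; elim: e1 t2 s2 => {p s t1 s1}.
- by move=> s t2 s2 e; inversion e.
- move=> i s s' st t2 s2 e; inversion e as [|? ? ? st'| | | |]; subst.
  by move: st'; rewrite st => -[->].
- move=> p q s s1 s2 t1 t2 _ IHp _ IHq t s' e.
  inversion e as [| |? ? ? ? ? ? ? ep eq| | |]; subst.
  by case: (IHp _ _ ep) => -> ?; subst; case: (IHq _ _ eq) => -> ->.
- move=> b p q s s' t _ IH t2 s2 e.
  inversion e as [| | |? ? ? ? ? ? ep| |]; subst.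
  by case: (IH _ _ ep) => -> ->.
- move=> b p s nb t2 s2 e.
  inversion e as [| | | | |? ? ? ? ? ? ? tb]; subst => //.
  by rewrite tb in nb.
- move=> b p s s1 s2 t1 t2 tb _ IHp _ IHw t s' e.
  inversion e as [| | | |? ? ? nb|? ? ? ? ? ? ? _ ep ew]; subst.
    by rewrite tb in nb.
  by case: (IHp _ _ ep) => -> ?; subst; case: (IHw _ _ ew) => -> ->.
Qed.

(* Input convention: the dimensions are in index registers 0 and 1, and
   arrays 0, 1, 2 hold Q in row-major order, c and d.  Everything else is
   unspecified. *)
Definition is_input (m n : nat) (Q : 'M[R]_(m, n)) (c : 'rV[R]_m)
    (d : 'rV[R]_n) (s : state) : Prop :=
  [/\ ireg s 0 = m /\ ireg s 1 = n,
      forall (i : 'I_m) (j : 'I_n), arr s 0 (i * n + j)%N = Q i j,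
      forall i : 'I_m, arr s 1 i = c 0 i
    & forall j : 'I_n, arr s 2 j = d 0 j].

(* Output convention: arrays 3 and 4 hold x and y as 0/1 scalars. *)
Definition is_output (m n : nat) (x : 'cV[bool]_m) (y : 'cV[bool]_n)
    (s : state) : Prop :=
  (forall i : 'I_m, arr s 3 i = (x i 0)%:R) /\
  (forall j : 'I_n, arr s 4 j = (y j 0)%:R).

End Semantics.

(* Main.v *)
Require Import Defs.
From mathcomp Require Import all_boot all_order all_algebra.
From mathcomp Require Import zify lra.

(** The objective extends to all real vectors, where it is affine in [x] for
    fixed [y] and affine in [y] for fixed [x].  Two consequences carry the
    theorem.

    The average over all 0/1 solutions is the value at the centre
    [(1/2, 1/2)] of the cube: pairing each bit vector with its complement
    replaces it by the centre without changing the sum, first in [x], then in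
    [y] ([bbqp_avg_center]).

    A function that is affine in [x] on the cube is at least as large at the
    0/1 vector that selects exactly the coordinates with positive coefficient
    as anywhere else on the cube ([relax_round_x], [relax_round_y]).  Starting
    from the centre, rounding all of [x] in this way against [y = 1/2], and
    then all of [y] against the rounded [x], never decreases the value.  The
    result is a 0/1 solution at least as good as the centre, hence as the
    average.

    Rounding a block takes one pass over the entries of [Q].  Both roundings
    are done by the same code [round_block], which walks through [Q] with two
    strides: by rows for [x], by columns for [y].  Since the strides are added
    to a pointer, no multiplication of indices is needed.  The programs are
    verified with a small logic of bounded-time executions ([runs]), whose rule
    for counting loops is [runs_while]. *)

Set Implicit Arguments.
Unset Strict Implicit.
Unset Printing Implicit Defensive.

Import Order.TTheory GRing.Theory Num.Theory.

Local Open Scope ring_scope.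

(** * The multi-affine relaxation of the objective *)

Section Relaxation.
Variable R : realFieldType.

Definition relax m n (Q : 'M[R]_(m, n)) (c : 'rV[R]_m) (d : 'rV[R]_n)
    (u : 'cV[R]_m) (v : 'cV[R]_n) : R :=
  (u^T *m Q *m v + c *m u + d *m v) 0 0.

Definition center k : 'cV[R]_k := const_mx 2^-1.

(** Exchanging the two blocks of variables lets every fact about [x] be reused
    for [y]. *)
Lemma relax_tr m n (Q : 'M[R]_(m, n)) c d u v :
  relax Q c d u v = relax Q^T d c v u.
Proof.
have Qtr : u^T *m Q *m v = (v^T *m Q^T *m u)^T.
  by rewrite !trmx_mul !trmxK mulmxA.
by rewrite /relax Qtr addrAC !mxE.
Qed.

(** The bracket is the coefficient whose sign decides how to round [u i]. *)
Lemma relaxE m n (Q : 'M[R]_(m, n)) c d u v :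
  relax Q c d u v =
  \sum_i u i 0 * (c 0 i + \sum_j Q i j * v j 0) + (d *m v) 0 0.
Proof.
rewrite /relax -mulmxA [LHS]mxE; congr (_ + _); rewrite !mxE -big_split /=.
by apply: eq_bigr => i _; rewrite !mxE mulrDr addrC [c 0 i * _]mulrC.
Qed.

Lemma relax_midpoint m n (Q : 'M[R]_(m, n)) c d u u' w v :
  u + u' = w + w ->
  relax Q c d u v + relax Q c d u' v = relax Q c d w v *+ 2.
Proof.
move=> /matrixP uw; rewrite mulr2n !relaxE !addrA; congr (_ + _).
rewrite ![_ + _ + \sum_i _]addrAC; congr (_ + _).
rewrite -!big_split; apply: eq_bigr => i _ /=.
by rewrite -!mulrDl; move: (uw i 0); rewrite !mxE => ->.
Qed.

Definition flip k (x : 'cV[bool]_k) : 'cV[bool]_k := map_mx negb x.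

Lemma flipK k : involutive (@flip k).
Proof. by move=> x; apply/matrixP=> i j; rewrite !mxE negbK. Qed.

Lemma bitvec_flip k (x : 'cV[bool]_k) :
  bitvec R x + bitvec R (flip x) = center k + center k.
Proof.
apply/matrixP => i j; rewrite !mxE.
have := @splitr R 1; rewrite mul1r => <-.
by case: (x i j); rewrite ?addr0 ?add0r.
Qed.

(** Summing over complementary pairs of bit vectors evaluates the relaxation
    at their common midpoint. *)
Lemma sum_relax_bits m n (Q : 'M[R]_(m, n)) c d v :
  \sum_(x : 'cV[bool]_m) relax Q c d (bitvec R x) v =
  \sum_(x : 'cV[bool]_m) relax Q c d (center m) v.
Proof.
apply: (@mulIf _ 2%:R); first by rewrite pnatr_eq0.
rewrite !mulr_natr mulr2n {2}(reindex_inj (inv_inj (@flipK m))) -big_split /=.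
rewrite -sumrMnl; apply: eq_bigr => x _; apply: relax_midpoint.
exact: bitvec_flip.
Qed.

Lemma bbqp_avg_center m n (Q : 'M[R]_(m, n)) c d :
  bbqp_avg Q c d = relax Q c d (center m) (center n).
Proof.
rewrite /bbqp_avg.
have -> : \sum_(s : 'cV[bool]_m * 'cV[bool]_n) bbqp_obj Q c d s.1 s.2 =
    \sum_(x : 'cV[bool]_m) \sum_(y : 'cV[bool]_n)
      relax Q c d (bitvec R x) (bitvec R y).
  by rewrite [RHS]pair_big.
(* Each of [x] and [y] in turn is the inner variable and moves to the centre. *)
rewrite exchange_big (eq_bigr _ (fun y _ => sum_relax_bits Q c d _)) /=.
rewrite exchange_big /= sumr_const.
rewrite (eq_bigr _ (fun y _ => relax_tr Q c d _ _)) sum_relax_bits -relax_tr.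
rewrite sumr_const !card_mx !card_bool !muln1 -mulrnA -expnD.
rewrite -[X in _ * X]mulr_natr natrX addnC mulrC mulfK //.
by rewrite expf_neq0 ?pnatr_eq0.
Qed.

(** Each term [a * g] with [a] in the unit interval is at most the positive
    part of [g], which is what the rounded coordinate contributes. *)
Lemma relax_round_x m n (Q : 'M[R]_(m, n)) (c : 'rV[R]_m) (d : 'rV[R]_n)
    (u : 'cV[R]_m) (v : 'cV[R]_n) (x : 'cV[bool]_m) :
  (forall i, 0 <= u i 0 <= 1) ->
  (forall i, x i 0 = (0 < c 0 i + \sum_j Q i j * v j 0)) ->
  relax Q c d u v <= relax Q c d (bitvec R x) v.
Proof.
move=> u01 xE; rewrite !relaxE lerD2r; apply: ler_sum => i _.
rewrite mxE xE; set g := _ + _; have /andP[u0 u1] := u01 i.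
case: ltP => g0 /=; first by rewrite ler_wpM2r // ltW.
by rewrite mul0r mulr_ge0_le0.
Qed.

Lemma relax_round_y m n (Q : 'M[R]_(m, n)) (c : 'rV[R]_m) (d : 'rV[R]_n)
    (u : 'cV[R]_m) (v : 'cV[R]_n) (y : 'cV[bool]_n) :
  (forall j, 0 <= v j 0 <= 1) ->
  (forall j, y j 0 = (0 < d 0 j + \sum_i Q i j * u i 0)) ->
  relax Q c d u v <= relax Q c d u (bitvec R y).
Proof.
move=> v01 yE; rewrite !(relax_tr Q); apply: relax_round_x => // j.
by rewrite yE; under [in RHS]eq_bigr do rewrite mxE.
Qed.

Lemma center01 k i : 0 <= center k i 0 <= 1.
Proof. by rewrite mxE; apply/andP; split; lra. Qed.

End Relaxation.

(** * Executions of bounded length *)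

Section Runs.
Variable R : realFieldType.
Implicit Types (s : state R) (p q : program) (Post : state R -> Prop).

Definition runs p s (T : nat) Post : Prop :=
  exists t s', [/\ exec p s t s', (t <= T)%N & Post s'].

Lemma runs_le T p s T' Post :
  runs p s T Post -> (T <= T')%N -> runs p s T' Post.
Proof.
move=> [t [s' [e le_t Ps']]] TT'; exists t, s'; split=> //.
exact: leq_trans TT'.
Qed.

Lemma runs_post Post p s T Post' :
  runs p s T Post -> (forall s', Post s' -> Post' s') -> runs p s T Post'.
Proof. by move=> [t [s' [e le_t /[swap] /[apply] Ps']]]; exists t, s'. Qed.

Lemma runs_skip s Post : Post s -> runs Skip s 1 Post.
Proof. by exists 1%N, s; split=> //; constructor. Qed.

Lemma runs_do i s s' Post :
  step i s = Some s' -> Post s' -> runs (Do i) s 1 Post.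
Proof. by move=> ss' Ps'; exists 1%N, s'; split=> //; constructor. Qed.

Lemma runs_seq Mid p q s T1 T2 Post :
  runs p s T1 Mid -> (forall s', Mid s' -> runs q s' T2 Post) ->
  runs (Seq p q) s (T1 + T2) Post.
Proof.
move=> [t1 [s1 [e1 le1 /[swap] /[apply]]]] [t2 [s2 [e2 le2 P2]]].
by exists (t1 + t2)%N, s2; split=> //; [apply: exec_seq e2 | apply: leq_add].
Qed.

Lemma runs_if b p q s T Post :
  runs (if eval_test b s then p else q) s T Post -> runs (If b p q) s T.+1 Post.
Proof.
by move=> [t [s' [e le Ps']]]; exists t.+1, s'; split=> //; constructor.
Qed.

(** The invariant is indexed by the number of completed iterations, which must
    determine the loop test; an iteration costs one step more than its body. *)
Lemma runs_while (Inv : nat -> state R -> Prop) b p N T s :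
  (forall k s, (k <= N)%N -> Inv k s -> eval_test b s = (k < N)%N) ->
  (forall k s, (k < N)%N -> Inv k s -> runs p s T (Inv k.+1)) ->
  Inv 0%N s -> runs (While b p) s (N * T.+1).+1 (Inv N).
Proof.
move=> test body.
suff loop r : forall k s, (k + r)%N = N -> Inv k s ->
    runs (While b p) s (r * T.+1).+1 (Inv N) by apply: loop.
elim: r => [|r IH] k {}s.
  rewrite addn0 => -> Inv_s; exists 1%N, s; split=> //.
  by apply: exec_while_done; rewrite (test N) ?ltnn.
move=> krN Inv_s; have kN : (k < N)%N by lia.
have [t1 [s1 [e1 le1 Inv1]]] := body k s kN Inv_s.
have [|t2 [s2 [e2 le2 Inv2]]] := IH k.+1 s1 _ Inv1; first by lia.
exists (t1 + t2).+1, s2; split=> //; last by rewrite mulSn; lia.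
by apply: exec_while_loop e1 e2; rewrite (test k) // ltnW.
Qed.

Definition block (code : seq instr) (p : program) : program :=
  foldr (fun i q => Seq (Do i) q) p code.

Definition steps (code : seq instr) (s : state R) : option (state R) :=
  foldl (fun os i => obind (step i) os) (Some s) code.

Lemma runs_block code p s s' T Post :
  steps code s = Some s' -> runs p s' T Post ->
  runs (block code p) s (size code + T) Post.
Proof.
rewrite /steps; elim: code s => [|i code IH] s /= ss' run.
  by case: ss' => ->.
case E: (step i s) ss' => [s1|] /=; last first.
  by move=> ss'; exfalso; elim: code {IH} ss'.
move=> ss'; rewrite addSn -add1n.
apply: (@runs_seq (fun s2 => s2 = s1)); first exact: runs_do E _.
by move=> _ ->; apply: IH.
Qed.

End Runs.

(** * Rounding one block of variables *)

(** Index registers below 8 and scalar registers below 2 are parameters, which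
    [round_block] leaves unchanged; the others are its scratch space.  [ione]
    and [izero] hold the constants 1 and 0: the instruction set increments and
    copies indices by adding these. *)
Local Notation nrows := 0%N (only parsing).
Local Notation ncols := 1%N (only parsing).
Local Notation ione := 2%N (only parsing).
Local Notation izero := 3%N (only parsing).
Local Notation size_out := 4%N (only parsing).
Local Notation size_in := 5%N (only parsing).
Local Notation stride_out := 6%N (only parsing).
Local Notation stride_in := 7%N (only parsing).
Local Notation pos_out := 8%N (only parsing).
Local Notation pos_in := 9%N (only parsing).
Local Notation base := 10%N (only parsing).
Local Notation ptr := 11%N (only parsing).

Local Notation szero := 0%N (only parsing).
Local Notation sone := 1%N (only parsing).
Local Notation acc := 2%N (only parsing).
Local Notation entry := 3%N (only parsing).
Local Notation weight := 4%N (only parsing).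

Local Notation arrQ := 0%N (only parsing).
Local Notation arrc := 1%N (only parsing).
Local Notation arrd := 2%N (only parsing).
Local Notation arrx := 3%N (only parsing).
Local Notation arry := 4%N (only parsing).

Definition add_term (wt : nat) : program :=
  block [:: ALoad entry arrQ ptr; ALoad weight wt pos_in;
            SMul entry entry weight; SAdd acc acc entry;
            IAdd ptr ptr stride_in; IAdd pos_in pos_in ione] Skip.

Definition round_one (lin wt out : nat) : program :=
  block [:: ALoad acc lin pos_out; IConst pos_in 0; IAdd ptr base izero]
    (Seq (While (ILt pos_in size_in) (add_term wt))
    (Seq (If (SLt szero acc) (Do (AStore out pos_out sone))
                             (Do (AStore out pos_out szero)))
    (block [:: IAdd base base stride_out; IAdd pos_out pos_out ione] Skip))).

(** Entry [k] of the output block becomes 1 exactly when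
    [lin k + \sum_l Q (k, l) * wt l] is positive.  With [wt] the current values
    of the other block, this is the coefficient of the variable [k] in the
    relaxation; the strides decide whether [k] numbers rows or columns. *)
Definition round_block (lin wt out : nat) : program :=
  block [:: IConst pos_out 0; IConst base 0]
    (While (ILt pos_out size_out) (round_one lin wt out)).

Section RoundBlock.
Variable R : realFieldType.
Implicit Types s : state R.

Definition same_params s s' : Prop :=
  (forall r, (r < 8)%N -> ireg s' r = ireg s r) /\
  (forall r, (r < 2)%N -> sreg s' r = sreg s r).

Lemma same_params_trans s1 s2 s3 :
  same_params s1 s2 -> same_params s2 s3 -> same_params s1 s3.
Proof.
by move=> [i12 s12] [i23 s23]; split=> r ltr; rewrite ?i23 ?s23 ?i12 ?s12.
Qed.

Lemma same_params_ireg s s' r v :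
  (8 <= r)%N -> same_params s s' -> same_params s (set_ireg s' r v).
Proof.
move=> ge_r [ip sp]; split=> // r' lt_r'; rewrite -ip //= /upd.
by case: eqP => // rE; move: lt_r'; rewrite rE ltnNge ge_r.
Qed.

Lemma same_params_sreg s s' r v :
  (2 <= r)%N -> same_params s s' -> same_params s (set_sreg s' r v).
Proof.
move=> ge_r [ip sp]; split=> // r' lt_r'; rewrite -sp //= /upd.
by case: eqP => // rE; move: lt_r'; rewrite rE ltnNge ge_r.
Qed.

Lemma same_params_arr s s' a k v :
  same_params s s' -> same_params s (set_arr s' a k v).
Proof. by []. Qed.

(** For straight-line code, whose final state is a nest of updates, all of them
    to scratch registers or arrays. *)
Ltac keep_params :=
  do !(apply: same_params_ireg => // || apply: same_params_sreg => // ||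
       apply: same_params_arr).

Definition params_ok s (K L sK sL : nat) : Prop :=
  [/\ ireg s ione = 1%N /\ ireg s izero = 0%N,
      ireg s size_out = K /\ ireg s size_in = L,
      ireg s stride_out = sK /\ ireg s stride_in = sL
    & sreg s szero = 0 /\ sreg s sone = 1].

(** Lets each loop look up its parameters in the state from which it started. *)
Lemma params_okW s s' K L sK sL :
  same_params s s' -> params_ok s K L sK sL -> params_ok s' K L sK sL.
Proof. by case=> ip sp [? ? ? ?]; split; rewrite ?ip ?sp. Qed.

Definition partial_sum s lin wt (sK sL k l : nat) : R :=
  arr s lin k + \sum_(j < l) arr s arrQ (k * sK + j * sL)%N * arr s wt j.

(** Here [s] is the state at the start of the inner loop, rather than of the
    whole round, so that the arrays are constant. *)
Definition inner_inv s lin wt (sK sL k l : nat) s' : Prop :=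
  [/\ same_params s s', arr s' = arr s,
      [/\ ireg s' pos_out = k, ireg s' base = (k * sK)%N, ireg s' pos_in = l
        & ireg s' ptr = (k * sK + l * sL)%N]
    & sreg s' acc = partial_sum s lin wt sK sL k l].

Lemma runs_add_term s K L sK sL lin wt k l s' :
  params_ok s K L sK sL -> inner_inv s lin wt sK sL k l s' ->
  runs (add_term wt) s' 7 (inner_inv s lin wt sK sL k l.+1).
Proof.
move=> ok [same arrE [kE baseE lE ptrE] accE].
have [[oneE _] [_ _] [_ sLE] _] := params_okW same ok.
apply: (@runs_block _ _ Skip _ _ 1); first by [].
apply: runs_skip; split=> //=.
- by keep_params.
- split=> //; rewrite /upd /=.
    by rewrite lE oneE addn1.
  by rewrite ptrE sLE mulSn; lia.
- by rewrite /upd /= accE lE ptrE arrE /partial_sum big_ord_recr addrA.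
Qed.

Definition round_inv s lin wt out (L sK sL k : nat) s' : Prop :=
  [/\ same_params s s', forall a, a != out -> arr s' a = arr s a,
      forall i, (i < k)%N ->
        arr s' out i = (0 < partial_sum s lin wt sK sL i L)%R%:R
    & ireg s' pos_out = k /\ ireg s' base = (k * sK)%N].

(** [round_inv] speaks of the coefficients computed from the initial arrays;
    the disequalities ensure that these are still the ones read when the
    variables before [k] have been written. *)
Lemma runs_round_one s K L sK sL lin wt out k s' :
  arrQ != out -> lin != out -> wt != out ->
  params_ok s K L sK sL -> round_inv s lin wt out L sK sL k s' ->
  runs (round_one lin wt out) s' (8 * L + 9)
    (round_inv s lin wt out L sK sL k.+1).
Proof.
move=> out0 out_lin out_wt ok [same arrE outE [kE baseE]].
have := params_okW same ok => ok'.
eapply runs_le.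
  apply: runs_block; first by [].
  set s1 := (X in runs _ X).
  have same1 : same_params s' s1.
    by keep_params.
  have ok1 := params_okW same1 ok'.
  have sumE i l :
      partial_sum s1 lin wt sK sL i l = partial_sum s lin wt sK sL i l.
    by rewrite /partial_sum /= !arrE.
  apply: (@runs_seq _ (inner_inv s1 lin wt sK sL k L)).
    apply: (@runs_while _ (inner_inv s1 lin wt sK sL k)) => [l s2 _||].
    - move=> [same2 _ [_ _ lE _] _] /=.
      by have [_ [_ ->] _ _] := params_okW same2 ok1; rewrite lE.
    - by move=> l s2 _; apply: runs_add_term ok1.
    - split=> //; rewrite /= /upd /= ?baseE ?kE.
        by have [[_ ->] _ _ _] := ok'; split=> //; rewrite mul0n.
      by rewrite /partial_sum big_ord0 addr0.
  move=> s2 [same2 arr2 [k2 base2 _ _] acc2].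
  have ok2 := params_okW same2 ok1.
  have [_ _ _ [zeroE oneE]] := ok2.
  apply: (@runs_seq _ (fun s3 => s3 = set_arr s2 out k
      (0 < partial_sum s lin wt sK sL k L)%R%:R)).
    apply: runs_if; rewrite /= zeroE acc2 sumE.
    by case: ltP => _; (eapply runs_do; first reflexivity);
      rewrite k2 ?zeroE ?oneE.
  move=> _ ->; apply: runs_block; first by [].
  apply: runs_skip.
  have [[ioneE _] _ [sKE _] _] := ok2.
  split=> /=.
  - apply: same_params_trans same _; apply: same_params_trans same1 _.
    by keep_params.
  - by move=> a a_out; rewrite /upd (negPf a_out) arr2 /= arrE.
  - move=> i; rewrite ltnS leq_eqVlt /upd eqxx => /predU1P[->|lt_ik].
      by rewrite eqxx.
    by rewrite (ltn_eqF lt_ik) arr2 /= outE.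
  - by rewrite /upd /= k2 base2 ioneE sKE mulSn addn1 addnC.
rewrite /=; lia.
Qed.

Lemma runs_round_block s K L sK sL lin wt out :
  arrQ != out -> lin != out -> wt != out -> params_ok s K L sK sL ->
  runs (round_block lin wt out) s (K * (8 * L + 10) + 3)
    (round_inv s lin wt out L sK sL K).
Proof.
move=> out0 out_lin out_wt ok; eapply runs_le.
  apply: runs_block; first by [].
  apply: (@runs_while _ (round_inv s lin wt out L sK sL)) => [k s' _||].
  - move=> [same _ _ [kE _]] /=.
    by have [_ [-> _] _ _] := params_okW same ok; rewrite kE.
  - by move=> k s' _; apply: runs_round_one ok.
  - split=> //=.
    by keep_params.
rewrite /=; lia.
Qed.

End RoundBlock.

(** * The algorithm *)

(** Sets the constants and puts [y] at the centre of its cube; [acc] holds 1/2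
    throughout the loop. *)
Definition fill_half : program :=
  block [:: IConst ione 1; IConst izero 0; SConst szero 0; SConst sone 1;
            SConst acc 2; SDiv acc sone acc; IConst pos_in 0]
    (While (ILt pos_in ncols)
      (block [:: AStore arry pos_in acc; IAdd pos_in pos_in ione] Skip)).

(** In row-major order, consecutive rows are [n] cells apart and consecutive
    columns one cell apart, whence the strides of the two rounds.  The first
    round reads the fractional [y], which the second one then overwrites. *)
Definition bbqp_program : program :=
  Seq fill_half
  (block [:: IAdd size_out nrows izero; IAdd size_in ncols izero;
             IAdd stride_out ncols izero; IAdd stride_in ione izero]
  (Seq (round_block arrc arry arrx)
  (block [:: IAdd size_out ncols izero; IAdd size_in nrows izero;
             IAdd stride_out ione izero; IAdd stride_in ncols izero]
  (round_block arrd arrx arry)))).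

Section Algorithm.
Variable R : realFieldType.
Variables (m n : nat) (Q : 'M[R]_(m, n)) (c : 'rV[R]_m) (d : 'rV[R]_n).

Definition filled (l : nat) (s : state R) : Prop :=
  [/\ is_input Q c d s, forall j, (j < l)%N -> arr s arry j = 2^-1,
      [/\ ireg s ione = 1%N, ireg s izero = 0%N & ireg s pos_in = l]
    & [/\ sreg s szero = 0, sreg s sone = 1 & sreg s acc = 2^-1]].

Lemma runs_fill_half s : is_input Q c d s ->
  runs fill_half s (4 * n + 8) (filled n).
Proof.
move=> inp; eapply runs_le.
  apply: runs_block.
    rewrite /steps /= /upd /= pnatr_eq0 /=; reflexivity.
  apply: (@runs_while _ filled _ _ n) => [l s' _||].
  - by move=> [[[_ nE] _ _ _] _ [_ _ lE] _] /=; rewrite lE nE.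
  - move=> l s' _ [inp' half [oneE zeroE lE] [? ? accE]].
    apply: runs_block; first by [].
    apply: runs_skip; split=> //=.
    + move=> j; rewrite ltnS leq_eqVlt /upd lE /= => /predU1P[->|lt_j].
        by rewrite eqxx accE.
      by rewrite (ltn_eqF lt_j) half.
    + by rewrite /upd /= lE oneE addn1.
  - by split=> //=; rewrite /upd /= mul1r.
rewrite /=; lia.
Qed.

Definition above_avg (s : state R) : Prop :=
  exists (x : 'cV[bool]_m) (y : 'cV[bool]_n),
    is_output x y s /\ bbqp_avg Q c d <= bbqp_obj Q c d x y.

Lemma runs_bbqp_program s : (0 < m)%N -> (0 < n)%N -> is_input Q c d s ->
  runs bbqp_program s (62 * (m * n)) above_avg.
Proof.
move=> m0 n0 inp; eapply runs_le.
  apply: runs_seq (runs_fill_half inp) _ => s1 [inp1 half1 [one1 zero1 _]].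
  move=> [szero1 sone1 _]; have [[m1 n1] Q1 c1 d1] := inp1.
  apply: runs_block; first by [].
  set s2 := (X in runs _ X).
  have ok2 : params_ok s2 m n n 1.
    by split; rewrite /= /upd /= ?m1 ?n1 ?zero1 ?one1 ?addn0.
  apply: runs_seq; first exact: runs_round_block ok2.
  move=> s3 [same3 arr3 out3 _].
  have [ones3 _ _ sconst3] := params_okW same3 ok2.
  have [m3 n3] : ireg s3 0 = m /\ ireg s3 1 = n.
    by have [ip _] := same3; rewrite !ip // /= /upd /= m1 n1.
  apply: runs_block; first by [].
  set s4 := (X in runs _ X).
  have ok4 : params_ok s4 n m 1 n.
    case: ones3 => one3 zero3.
    by split; rewrite /= /upd /= ?m3 ?n3 ?zero3 ?one3 ?addn0.
  eapply runs_post; first exact: runs_round_block ok4.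
  move=> s5 [_ arr5 out5 _].
  pose x : 'cV[bool]_m := \col_i (0 < partial_sum s2 arrc arry n 1 i n).
  pose y : 'cV[bool]_n := \col_j (0 < partial_sum s4 arrd arrx 1 n j m).
  have xout (i : 'I_m) : arr s3 3 i = bitvec R x i 0 by rewrite out3 // !mxE.
  exists x, y; split.
    split=> [i|j]; last by rewrite out5 // mxE.
    by rewrite arr5 //= xout mxE.
  rewrite bbqp_avg_center.
  apply: (@le_trans _ _ (relax Q c d (bitvec R x) (center R n))).
    apply: relax_round_x => [i|i]; first exact: center01.
    rewrite mxE /partial_sum /= c1; congr (0 < _ + _).
    by apply: eq_bigr => j _; rewrite muln1 Q1 half1 // mxE.
  apply: relax_round_y => [j|j]; first exact: center01.
  rewrite mxE /partial_sum /= arr3 //= d1; congr (0 < _ + _).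
  by apply: eq_bigr => i _; rewrite xout arr3 //= muln1 addnC Q1.
rewrite /=; nia.
Qed.

End Algorithm.

Theorem corollary11 :
  exists (P : program) (C : nat),
  forall (R : realFieldType) (m n : nat) (Q : 'M[R]_(m, n))
    (c : 'rV[R]_m) (d : 'rV[R]_n),
  (0 < m)%N -> (0 < n)%N ->
  forall s : state R, is_input Q c d s ->
  exists (t : nat) (s' : state R) (x : 'cV[bool]_m) (y : 'cV[bool]_n),
    [/\ exec P s t s',
        (t <= C * (m * n))%N,
        is_output x y s'
      & bbqp_avg Q c d <= bbqp_obj Q c d x y].
Proof.
exists bbqp_program, 62%N => R m n Q c d m0 n0 s inp.
have [t [s' [run le_t [x [y [out good]]]]]] := runs_bbqp_program m0 n0 inp.
by exists t, s', x, y.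
Qed.
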